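(* Suppose that the margin condition holds with constants $\kappa\ge1$ and $C>0$, that is, $$P(\gamma_j-\gamma_0)\ge d(f_j,f_0)^{2\kappa}/C^{2\kappa},\qquad j=1,\dots,p,$$ and that the exponential moment condition holds for some $K>0$, that is, $P|\gamma_j^c-\gamma_*^c|^m\le\frac{m!}{2}(2K)^{m-2}d^2(f_j,f_* )$ for all $m=2,3,\dots$ and all $j=1,\dots,p$. Let $$A(\kappa):=\frac{1+(2\kappa-1)^{\frac1{2\kappa-1}}}{(2\kappa)^{\frac1{2\kappa-1}}}<2.$$ Then for $\mathcal E_*>0$ and all $t>0$, $$\mathbf P\left(\hat{\mathcal E}^{\frac1{2\kappa}}\ge\mathcal E_*^{\frac1{2\kappa}}+A(\kappa)\left(C\sqrt{\Delta+2t/n}+\frac{K(\Delta+2t/n)}{\mathcal E_*^{\frac1{2\kappa}}}\right)^{\frac1{2\kappa-1}}\right)\le e^{-t}.$$ Moreover, for $t>0$ with $\mathcal E_*\le K(\Delta+2t/n)$, $$\mathbf P\left(\hat{\mathcal E}^{\frac1{2\kappa}}\ge A(\kappa)\left(C\sqrt{\Delta+2t/n}\right)^{\frac1{2\kappa-1}}+2\left(K(\Delta+2t/n)\right)^{\frac1{2\kappa}}\right)\le e^{-t}.$$ Furthermore, for all $1\le m\le(1+\log p)(2\kappa-1)$, when $\mathcal E_*>0$, $$\left\|\hat{\mathcal E}^{\frac1{2\kappa}}\right\|_m\le\mathcal E_*^{\frac1{2\kappa}}+A(\kappa)\left(C\sqrt\Delta+\frac{K\Delta}{\mathcal E_*^{\frac1{2\kappa}}}\right)^{\frac1{2\kappa-1}},$$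 and when $\mathcal E_*\le K\Delta$, $$\left\|\hat{\mathcal E}^{\frac1{2\kappa}}\right\|_m\le A(\kappa)\left(C\sqrt\Delta\right)^{\frac1{2\kappa-1}}+2(K\Delta)^{\frac1{2\kappa}}.$$
   Context: $Z_1,\dots,Z_n$ are independent (not necessarily identically distributed) random variables in a space $\mathcal Z$; $\mathbf P$ and $\mathbf E$ denote their distribution and expectation. For $\gamma:\mathcal Z\to\mathbb R$ put $P\gamma:=\frac1n\sum_{i=1}^n\mathbf E\gamma(Z_i)$ and $P_n\gamma:=\frac1n\sum_{i=1}^n\gamma(Z_i)$. $\gamma^c:=\gamma-\mathbf E\gamma$ denotes the centered function, i.e. $\gamma^c(Z_i)=\gamma(Z_i)-\mathbf E\gamma(Z_i)$ for each $i$, and $P|\gamma^c|^m=\frac1n\sum_i\mathbf E|\gamma^c(Z_i)|^m$. $\mathbf F$ is a subset of a metric space with metric $d$, and $\boldsymbol\Gamma=\{\gamma_f:f\in\mathbf F\}$ is a class of loss functions $\gamma_f:\mathcal Z\to\mathbb R$. Fixed (non-random) $f_1,\dots,f_p\in\mathbf F$ are given and $\gamma_j:=\gamma_{f_j}$. The empirical risk minimizer is $\hat\gamma:=\arg\min_{1\le j\le p}P_n\gamma_j$; the target is $\gamma_0=\gamma_{f_0}:=\arg\min_{\gamma\in\boldsymbol\Gamma}P\gamma$; the best approximation is $\gamma_*=\gamma_{f_*}:=\arg\min_{1\le j\le p}P\gamma_j$, with $f_*\in\{f_1,\dots,f_p\}$. Excess risks: $\hat{\mathcal E}:=P(\hat\gamma-\gamma_0)$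 (a random variable: $P(\gamma_j-\gamma_0)$ evaluated at the selected index $j$) and $\mathcal E_*:=P(\gamma_*-\gamma_0)$. Also $\Delta:=2\log(2p)/n$ and $\|X\|_m:=(\mathbf E|X|^m)^{1/m}$. *)

(* Defs.v *)
From HB Require Import structures.
From mathcomp Require Import all_boot all_order all_algebra.
From mathcomp Require Import all_classical all_reals all_analysis.

Set Implicit Arguments.
Unset Strict Implicit.
Unset Printing Implicit Defensive.
Import Order.TTheory GRing.Theory Num.Theory.

Local Open Scope classical_set_scope.
Local Open Scope ring_scope.

Definition mutually_independent d d' (T : measurableType d)
    (U : measurableType d') (R : realType) (Pr : probability T R) (n : nat)
    (Z : 'I_n -> {RV Pr >-> U}) : Prop :=
  forall (J : {set 'I_n}) (B : 'I_n -> set U),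
    (forall i, i \in J -> measurable (B i)) ->
    Pr (\bigcap_(i in [set` J]) Z i @^-1` B i) =
    (\prod_(i in J) Pr (Z i @^-1` B i))%E.

Definition centered d (T : measurableType d) (R : realType)
    (Pr : probability T R) (X : T -> R) : T -> R :=
  fun w => X w - fine 'E_Pr[X].

(* Kept extended-real, so that a bound on it for a nonnegative family X
   entails finiteness of the expectations. *)
Definition mean_expectation d (T : measurableType d) (R : realType)
    (Pr : probability T R) (n : nat) (X : 'I_n -> T -> R) : \bar R :=
  ((n%:R^-1)%:E * \sum_(i < n) 'E_Pr[X i])%E.

(* P g; only meaningful when every g (Z_i) is integrable. *)
Definition theoretical_mean d d' (T : measurableType d)
    (U : measurableType d') (R : realType) (Pr : probability T R) (n : nat)
    (Z : 'I_n -> {RV Pr >-> U}) (g : U -> R) : R :=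
  fine (mean_expectation Pr (fun i => g \o Z i)).

(* P_n g, evaluated at the sample point w. *)
Definition empirical_mean d d' (T : measurableType d)
    (U : measurableType d') (R : realType) (Pr : probability T R) (n : nat)
    (Z : 'I_n -> {RV Pr >-> U}) (g : U -> R) (w : T) : R :=
  n%:R^-1 * \sum_(i < n) g (Z i w).

(* P |g^c - h^c|^m; the centering of g is by E g(Z_i), hence depends on i. *)
Definition centered_moment d d' (T : measurableType d)
    (U : measurableType d') (R : realType) (Pr : probability T R) (n : nat)
    (Z : 'I_n -> {RV Pr >-> U}) (g h : U -> R) (m : nat) : \bar R :=
  mean_expectation Pr
    (fun i w =>
       `|centered Pr (g \o Z i) w - centered Pr (h \o Z i) w| ^+ m).

Definition A_const (R : realType) (kappa : R) : R :=
  (1 + (2 * kappa - 1) `^ (2 * kappa - 1)^-1) /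
  (2 * kappa) `^ (2 * kappa - 1)^-1.

(* Main.v *)
Require Import Defs.
From HB Require Import structures.
From mathcomp Require Import all_boot all_order all_algebra.
From mathcomp Require Import all_classical all_reals all_analysis.
From mathcomp Require Import measurable_realfun.
From mathcomp Require Import ring lra.

Set Implicit Arguments.
Unset Strict Implicit.
Unset Printing Implicit Defensive.
Import Order.TTheory GRing.Theory Num.Theory.
Import numFieldNormedType.Exports.

Local Open Scope classical_set_scope.
Local Open Scope ring_scope.

(* Write [x_j] for the [2 kappa]-th root of the excess risk of [gamma_j], and
   [y = x_jstar].  By minimality of the empirical risk, the difference of the
   excess risks of the selected and of the best candidate is at most [V_jhat],
   where [V_j] is the centred empirical mean of [gamma_jstar - gamma_j].  By the
   margin condition [d(f_j, f_jstar) <= C (x_j + y)], so Bernstein's exponential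
   inequality gives [E exp(n D V_j / a_j) <= exp(n D / 2)] with
   [a_j = C sqrt D (x_j + y) + 2 K D], for every [D > 0].
   Taking [D = Delta + 2 t / n], a union bound controls the event
   [V_jhat >= a_jhat], and an inequality on powers turns
   [x^(2 kappa) - y^(2 kappa) < a_jhat] into the upper bound on [x = x_jhat].
   For the moments, take [D = Delta] and let [u] be the positive part of
   [V_jhat / a_jhat]: then [x <= Y + H u^r], and since
   [n Delta = 2 ln (2 p) >= 1 + ln p >= m r], the [m]-th power of [u^r] is bounded
   by an affine function of [exp(n Delta (u - 1))], whose mean is at most 1. *)

(** * Inequalities on real powers and on the exponential *)

Lemma powR_add2 (R : realType) (x s : R) : 1 <= s -> 0 <= x ->
  x `^ (s + 1) = x ^+ 2 * x `^ (s - 1).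
Proof.
move=> s1 x0; rewrite -powR_mulrn// -powRD; first by congr powR; lra.
by apply/implyP => /eqP; lra.
Qed.

Lemma powR_mul1 (R : realType) (x s : R) : 1 <= s -> 0 <= x ->
  x `^ s = x * x `^ (s - 1).
Proof. by move=> s1 x0; rewrite mulr_powRB1//; lra. Qed.

(* [x^(s+1) = x^(s-1) x^2], so replacing [y^(s-1)] and [w^(s-1)] by the larger
   [x^(s-1)] reduces the claim to [x^2 - y^2 = (x - y) (x + y)]. *)
Lemma powR_increment_ge (R : realType) (s x y w : R) :
  1 <= s -> 0 <= y -> 0 <= w -> y + w <= x ->
  w `^ s * (x + y) + x `^ (s - 1) * (x + y) * (x - y - w) <=
  x `^ (s + 1) - y `^ (s + 1).
Proof.
move=> s1 y0 w0 ywx; have x0 : 0 <= x by lra.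
rewrite !powR_add2// (powR_mul1 s1 w0).
have pw_le u : 0 <= u -> u <= x -> u `^ (s - 1) <= x `^ (s - 1).
  by move=> u0 ux; apply: ge0_ler_powR; rewrite ?nnegrE//; lra.
have wx : w * (x + y) * w `^ (s - 1) <= w * (x + y) * x `^ (s - 1).
  by rewrite ler_wpM2l ?pw_le ?mulr_ge0//; lra.
have yx : y ^+ 2 * y `^ (s - 1) <= y ^+ 2 * x `^ (s - 1).
  by rewrite ler_wpM2l ?pw_le ?sqr_ge0//; lra.
move: wx yx; set a := x `^ _; set b := w `^ _; set c := y `^ _ => wx yx.
have -> : w * b * (x + y) = w * (x + y) * b by ring.
have -> : a * (x + y) * (x - y - w) =
  x ^+ 2 * a - y ^+ 2 * a - w * (x + y) * a by ring.
lra.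
Qed.

(* The left-hand side is largest, and the right-hand side smallest, at [y = z];
   there [powR_increment_ge] applies, with [z c] units to spare. *)
Lemma powR_increment_ge_small (R : realType) (s x y z w c : R) :
  1 <= s -> 0 <= y -> y <= z -> 0 <= w -> 0 <= c -> w + z * (1 + c) <= x ->
  w `^ s * (x + y) + 2 * c `^ s * z `^ (s + 1) +
    x `^ (s - 1) * (x + z) * (x - w - z * (1 + c)) <=
  x `^ (s + 1) - y `^ (s + 1).
Proof.
move=> s1 y0 yz w0 c0 hx; have z0 : 0 <= z by lra.
have zc0 : 0 <= z * c by rewrite mulr_ge0.
have x0 : 0 <= x by move: hx; rewrite mulrDr mulr1; lra.
have zwx : z + w <= x by move: hx; rewrite mulrDr mulr1; lra.
have := powR_increment_ge s1 z0 w0 zwx.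
have yz' : y `^ (s + 1) <= z `^ (s + 1).
  by apply: ge0_ler_powR; rewrite ?nnegrE//; lra.
have ws : w `^ s * (x + y) <= w `^ s * (x + z).
  by rewrite ler_wpM2l ?powR_ge0//; lra.
suff : 2 * c `^ s * z `^ (s + 1) <= x `^ (s - 1) * (x + z) * (z * c).
  move=> H1 H2.
  have -> : x - w - z * (1 + c) = (x - z - w) - z * c by ring.
  rewrite mulrBr; lra.
have zcx : z * c <= x by move: hx; rewrite mulrDr mulr1; lra.
have xs : z `^ (s - 1) * c `^ (s - 1) <= x `^ (s - 1).
  by rewrite -powRM//; apply: ge0_ler_powR; rewrite ?nnegrE//; lra.
rewrite powR_add2// (powR_mul1 s1 c0).
have -> : 2 * (c * c `^ (s - 1)) * (z ^+ 2 * z `^ (s - 1)) =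
  (z `^ (s - 1) * c `^ (s - 1)) * (2 * z) * (z * c) by ring.
apply: ler_wpM2r => //; apply: ler_pM => //; rewrite ?mulr_ge0 ?powR_ge0//.
lra.
Qed.

(** With [s = 2 k - 1] and [v = s^(1/s)], one has [(1 + v)^s = (1 + v) (1 + v)^(s-1) >= 1 + v^s = 1
    + s]; then take [s]-th roots. This feeds [ge_mul_powR_r]. *)
Lemma A_const_ge1 (R : realType) (k : R) : 1 <= k ->
  1 <= A_const k.
Proof.
move=> k1; rewrite /A_const; set s := 2 * k - 1; have -> : 2 * k = 1 + s by rewrite /s; lra.
have s1 : 1 <= s by rewrite /s; lra.
have r0 : 0 < s^-1 by rewrite invr_gt0; lra.
have D0 : 0 < (1 + s) `^ s^-1 by rewrite powR_gt0; lra.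
rewrite ler_pdivlMr// mul1r.
have H0 : 0 <= 1 + s `^ s^-1 by rewrite addr_ge0// powR_ge0.
have : 1 + s <= (1 + s `^ s^-1) `^ s.
  rewrite (powR_mul1 s1)//.
  have h1 : 1 <= (1 + s `^ s^-1) `^ (s - 1).
    rewrite -[leLHS](powRr0 (1 + s `^ s^-1)) ler_powR//.
      by rewrite lerDl powR_ge0.
    lra.
  have h2 : s = s `^ s^-1 * (s `^ s^-1) `^ (s - 1).
    by rewrite -powR_mul1// ?powR_ge0// -powRrM mulVf ?powRr1//; lra.
  have h3 : (s `^ s^-1) `^ (s - 1) <= (1 + s `^ s^-1) `^ (s - 1).
    by apply: ge0_ler_powR; rewrite ?nnegrE ?powR_ge0//; lra.
  by rewrite mulrDl mul1r lerD// {1}h2 ler_wpM2l// powR_ge0.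
move=> H; have -> : 1 + s `^ s^-1 = ((1 + s `^ s^-1) `^ s) `^ s^-1.
  by rewrite -powRrM mulfV ?powRr1//; lra.
by apply: ge0_ler_powR; rewrite ?nnegrE ?powR_ge0//; lra.
Qed.

(** With [s = 2 k - 1], both terms of the numerator, [1^(1/s)] and [s^(1/s)], lie strictly below the
    denominator [(1 + s)^(1/s)]. *)
Lemma A_const_lt2 (R : realType) (k : R) : 1 <= k ->
  A_const k < 2.
Proof.
move=> k1; rewrite /A_const; set s := 2 * k - 1; have -> : 2 * k = 1 + s by rewrite /s; lra.
have s1 : 1 <= s by rewrite /s; lra.
have r0 : 0 < s^-1 by rewrite invr_gt0; lra.
have D0 : 0 < (1 + s) `^ s^-1 by rewrite powR_gt0; lra.
rewrite ltr_pdivrMr// mulr_natl mulr2n.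
have lt u : 0 <= u -> u < 1 + s -> u `^ s^-1 < (1 + s) `^ s^-1.
  by move=> u0 us; apply: gt0_ltr_powR; rewrite ?nnegrE//; lra.
rewrite ltrD ?lt//; last lra; last lra.
rewrite [ltLHS](_ : _ = 1 `^ s^-1); last by rewrite powR1.
by apply: lt; lra.
Qed.

(** Convexity of the exponential between [0] and [t]. After dividing by [exp(c t)], the tangent
    bound [1 + v <= exp v] is used at [v = - c t] and [v = t - c t], whose mean with weights [1 - c]
    and [c] is zero. *)
Lemma expR_mul_le (R : realType) (c t : R) : 0 <= c <= 1 ->
  expR (c * t) <= 1 + c * (expR t - 1).
Proof.
move=> /andP[c0 c1].
have h1 := expR_ge1Dx (t - c * t); have h2 := expR_ge1Dx (- (c * t)).
have e0 := expR_gt0 (c * t).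
have E1 : expR t = expR (c * t) * expR (t - c * t) by rewrite -expRD; congr expR; lra.
have E2 : 1 = expR (c * t) * expR (- (c * t)) by rewrite -expRD subrr expR0.
have -> : 1 + c * (expR t - 1) = (1 - c) * 1 + c * expR t by ring.
rewrite {2}E2 E1.
have -> : (1 - c) * (expR (c * t) * expR (- (c * t))) + c * (expR (c * t) * expR (t - c * t)) =
  expR (c * t) * ((1 - c) * expR (- (c * t)) + c * expR (t - c * t)) by ring.
rewrite ler_peMr ?(ltW e0)//.
have h3 : (1 - c) * (1 - c * t) <= (1 - c) * expR (- (c * t)).
  by rewrite ler_wpM2l//; lra.
have h4 : c * (1 + (t - c * t)) <= c * expR (t - c * t) by rewrite ler_wpM2l.
suff : 1 = (1 - c) * (1 - c * t) + c * (1 + (t - c * t)) by lra.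
ring.
Qed.

Lemma powR_le_expR (R : realType) (m u : R) : 0 <= m -> 0 <= u ->
  u `^ m <= expR (m * (u - 1)).
Proof.
move=> m0 u0; rewrite mulrC expRM; apply: ge0_ler_powR; rewrite ?nnegrE ?expR_ge0//.
by have := expR_ge1Dx (u - 1); lra.
Qed.

(* [x / (y + h)] is at most a convex combination of [1] and [u^r]; by convexity of
   the [m]-th power it remains to bound [u^(m r)], for which
   [u^(m r) <= exp(m r (u - 1)) <= 1 + m r / b (exp(b (u - 1)) - 1)]. *)
Lemma powR_moment_le (R : realType) (x y h u r m b : R) :
  1 <= m -> 0 <= r -> 0 <= y -> 0 <= h -> 0 < y + h -> 0 <= x -> 0 <= u ->
  0 < b -> m * r <= b -> x <= y + h * u `^ r ->
  x `^ m <= (y + h) `^ m *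
    (1 + h / (y + h) * (m * r / b) * (expR (b * (u - 1)) - 1)).
Proof.
move=> m1 r0 y0 h0 yh0 x0 u0 b0 mrb hx.
set t := h / (y + h).
have t0 : 0 <= t by rewrite divr_ge0// ltW.
have t1 : t <= 1 by rewrite ler_pdivrMr//; lra.
have ur0 : 0 <= u `^ r by rewrite powR_ge0.
have hx' : x <= (y + h) * ((1 - t) * 1 + t * u `^ r).
  rewrite mulrDr mulr1 mulrBr mulr1 mulrA.
  rewrite /t mulrCA divff ?gt_eqF// mulr1.
  by move: hx; set v := h * _; lra.
have c0 : 0 <= (1 - t) * 1 + t * u `^ r.
  by rewrite mulr1 addr_ge0 ?subr_ge0// mulr_ge0.
apply: (@le_trans _ _ (((y + h) * ((1 - t) * 1 + t * u `^ r)) `^ m)).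
  by apply: ge0_ler_powR => //; rewrite ?nnegrE ?mulr_ge0//; lra.
rewrite powRM//; last lra.
rewrite ler_wpM2l ?powR_ge0//.
have t01 : 0 <= 1 - t <= 1 by lra.
have := @convex_powR R m m1 (Itv01 (proj1 (andP t01)) (proj2 (andP t01))) 1 (u `^ r).
rewrite !inE/= !in_itv/= !andbT => /(_ ler01 ur0).
rewrite [X in X `^ _ <= _]convRE convRE /= /unstable.onem opprB addrCA subrr addr0 powR1 => cvx.
apply: (le_trans cvx); rewrite mulr1.
have mr0 : 0 <= m * r by rewrite mulr_ge0//; lra.
have : (u `^ r) `^ m <= 1 + m * r / b * (expR (b * (u - 1)) - 1).
  rewrite -powRrM mulrC; apply: (le_trans (powR_le_expR mr0 u0)).
  have -> : m * r * (u - 1) = m * r / b * (b * (u - 1)) by field; lra.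
  apply: expR_mul_le; rewrite divr_ge0 ?(ltW b0)//= ler_pdivrMr//; lra.
set E := _ - 1; set v := powR _ m; set q := m * r / b => vle.
have := ler_wpM2l t0 vle.
have -> : 1 + t * q * E = (1 - t) + t * (1 + q * E) by ring.
lra.
Qed.

(** * Expectation of a product of functions of independent variables *)

Section independence.
Import HBNNSimple.

(** The hypothesis on [c] says that the image under [Y] of the measure with density [W] is [c] times
    the image of [mu]; it is applied to the level sets of [h]. *)
Lemma integral_weighted_nnsfun d d' (T : measurableType d)
    (U : measurableType d') (R : realType) (mu : {measure set T -> \bar R})
    (W : T -> R) (Y : T -> U) (c : \bar R) (h : {nnsfun U >-> R}) :
  measurable_fun setT W -> (forall w, 0 <= W w) -> measurable_fun setT Y ->
  (forall B, measurable B ->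
     (\int[mu]_w (W w * \1_B (Y w))%:E = c * mu (Y @^-1` B))%E) ->
  (\int[mu]_w (W w * h (Y w))%:E =
   \sum_(y \in range h) y%:E * (c * mu (Y @^-1` (h @^-1` [set y]))))%E.
Proof.
move=> mW W0 mY WB.
have mWi y : measurable_fun setT (fun w => W w * \1_(h @^-1` [set y]) (Y w)).
  apply: measurable_funM => //; apply: measurableT_comp => //.
have y0 y w : (0 <= (y * (W w * \1_(h @^-1` [set y]) (Y w)))%:E)%E.
  rewrite lee_fin indicE; case: (boolP (_ \in _)); last by rewrite !mulr0.
  by rewrite inE/= => <-; rewrite mulr_ge0// mulr1.
transitivity (\int[mu]_w (\sum_(y \in range h)
    (y * (W w * \1_(h @^-1` [set y]) (Y w)))%:E))%E.
  apply: eq_integral => w _; rewrite fsumEFin// fimfunE !fsbig_finite//= mulr_sumr.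
  by congr EFin; apply: eq_bigr => y _; rewrite mulrCA.
rewrite ge0_integral_fsum//; last by move=> y; exact/measurable_EFinP/measurable_funM.
apply: eq_fsbigr => y; rewrite inE => -[u _ huy].
rewrite -WB//.
under eq_integral do rewrite EFinM.
rewrite ge0_integralZl//.
- exact/measurable_EFinP.
- by move=> w _; rewrite lee_fin mulr_ge0.
- by rewrite lee_fin -huy.
Qed.

Lemma integral_weighted_comp d d' (T : measurableType d)
    (U : measurableType d') (R : realType) (mu : {measure set T -> \bar R})
    (W : T -> R) (Y : T -> U) (c : \bar R) (f : U -> R) :
  measurable_fun setT W -> (forall w, 0 <= W w) -> measurable_fun setT Y ->
  (0 <= c)%E -> c \is a fin_num ->
  (forall B, measurable B ->
     (\int[mu]_w (W w * \1_B (Y w))%:E = c * mu (Y @^-1` B))%E) ->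
  measurable_fun setT f -> (forall u, 0 <= f u) ->
  (\int[mu]_w (W w * f (Y w))%:E = c * \int[mu]_w (f (Y w))%:E)%E.
Proof.
move=> mW W0 mY c0 cfin WB mf f0.
have mEf : measurable_fun setT (EFin \o f) by exact/measurable_EFinP.
pose h := nnsfun_approx measurableT mEf.
(* The weight is left general: it is [W] on one side of the claim and the constant 1 on the
   other. *)
have lim_h (V : T -> R) : measurable_fun setT V -> (forall w, 0 <= V w) ->
    (\int[mu]_w (V w * f (Y w))%:E =
     limn (fun k => \int[mu]_w (V w * h k (Y w))%:E))%E.
  move=> mV V0.
  have fE w : (V w * f (Y w))%:E = limn (fun k => (V w * h k (Y w))%:E).
    apply/esym/cvg_lim => //; rewrite EFinM.
    under eq_fun do rewrite EFinM.
    apply: cvgeZl => //.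
    by apply: (@cvg_nnsfun_approx _ _ _ _ measurableT _ mEf) => // u _; rewrite lee_fin.
  under eq_integral do rewrite fE.
  apply: monotone_convergence => //.
  - move=> k; apply/measurable_EFinP/measurable_funM => //.
    by apply: measurableT_comp.
  - by move=> k w _; rewrite lee_fin mulr_ge0.
  - move=> w _ a b ab; rewrite lee_fin ler_wpM2l//.
    by apply/lefP/nd_nnsfun_approx.
have h1 k : (\int[mu]_w (W w * h k (Y w))%:E = c * \int[mu]_w (1 * h k (Y w))%:E)%E.
  rewrite (integral_weighted_nnsfun (h k) mW W0 mY WB).
  rewrite (@integral_weighted_nnsfun _ _ _ _ _ mu (cst 1) Y 1%E (h k))//=.
    rewrite ge0_mule_fsumr; last first.
      move=> y; rewrite mul1e; have [->|] := eqVneq (Y @^-1` (h k @^-1` [set y])) set0.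
        by rewrite measure0 mule0.
      case/set0P => w /= hy; rewrite mule_ge0// lee_fin -hy//.
    by apply: eq_fsbigr => y _; rewrite mul1e muleCA.
  move=> B mB; under eq_integral do rewrite mul1r.
  rewrite mul1e (integral_indic mu measurableT (A := Y @^-1` B)) ?setIT//.
  by rewrite -[X in measurable X]setTI; exact: mY.
rewrite (lim_h W)//.
under eq_fun do rewrite h1.
have -> : (\int[mu]_w (f (Y w))%:E = \int[mu]_w (1 * f (Y w))%:E)%E.
  by apply: eq_integral => w _; rewrite mul1r.
rewrite (lim_h (cst 1))//=.
rewrite limeMl//.
apply: ereal_nondecreasing_is_cvgn => a b ab; apply: ge0_le_integral => //.
- by move=> w _; rewrite lee_fin mul1r.
- by apply/measurable_EFinP/measurable_funM => //; exact: measurableT_comp.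
- by apply/measurable_EFinP/measurable_funM => //; exact: measurableT_comp.
- by move=> w _; rewrite lee_fin !mul1r; apply/lefP/nd_nnsfun_approx.
Qed.

(* Indicators are replaced by general functions one coordinate at a time: [J] is
   the set of coordinates already treated. *)
Lemma integral_prod_indep d d' (T : measurableType d) (U : measurableType d')
    (R : realType) (Pr : probability T R) (n : nat)
    (Z : 'I_n -> {RV Pr >-> U}) (g : 'I_n -> U -> R) :
  mutually_independent Z ->
  (forall i, measurable_fun setT (g i)) -> (forall i u, 0 <= g i u) ->
  (forall i, \int[Pr]_w (g i (Z i w))%:E < +oo)%E ->
  (\int[Pr]_w (\prod_(i < n) g i (Z i w))%:E =
   \prod_(i < n) \int[Pr]_w (g i (Z i w))%:E)%E.
Proof.
move=> indZ; pose P (g : 'I_n -> U -> R) :=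
  [/\ forall i, measurable_fun setT (g i), forall i u, 0 <= g i u &
      forall i, (\int[Pr]_w (g i (Z i w))%:E < +oo)%E].
suff H (J : {set 'I_n}) : forall g, P g ->
    (forall i, i \notin J -> exists2 B, measurable B & g i = \1_B) ->
  (\int[Pr]_w (\prod_(i < n) g i (Z i w))%:E =
   \prod_(i < n) \int[Pr]_w (g i (Z i w))%:E)%E.
  move=> mg g0 gfin; apply: (H [set: 'I_n]%SET) => // i; by rewrite finset.in_setT.
have mpre i B : measurable B -> measurable (Z i @^-1` B).
  by move=> mB; rewrite -[X in measurable X]setTI; exact: measurable_funP.
have intB : forall (i : 'I_n) (B : set U), measurable B ->
    (\int[Pr]_w (\1_B (Z i w))%:E = Pr (Z i @^-1` B))%E.
  move=> i B mB; rewrite (integral_indic Pr measurableT (A := Z i @^-1` B)) ?setIT//.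
  exact: mpre.
have [k] := ubnP #|J|; elim: k J => // k IH J Jk {}g [mg g0 gfin] gJ.
have [J0|[i0 i0J]] := set_0Vmem J.
  have {}gJ i : exists2 B, measurable B & g i = \1_B by apply: gJ; rewrite J0 inE.
  pose B i := projT1 (cid2 (gJ i)).
  have mB i : measurable (B i) by rewrite /B; case: cid2.
  have gB i : g i = \1_(B i) by rewrite /B; case: cid2.
  under [RHS]eq_bigr do rewrite gB intB//.
  have /= := indZ [set: 'I_n]%SET B (fun i _ => mB i).
  under eq_bigl do rewrite inE.
  move=> <-.
  have mC : measurable (\bigcap_(i in [set` [set: 'I_n]%SET]) Z i @^-1` B i).
    apply: fin_bigcap_measurable; first exact: finite_finset.
    by move=> i _; exact: mpre.
  rewrite -[X in _ = Pr X]setIT -(integral_indic Pr measurableT)//.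
  apply: eq_integral => w _; congr EFin.
  rewrite indicE; case: (boolP (w \in _)) => [|wN].
    rewrite inE => wB; rewrite big1// => i _.
    by rewrite gB indicE mem_set//; apply: wB; rewrite /= inE.
  apply/eqP/negPn/negP => /prodf_neq0 hB.
  move/negP: wN; apply; rewrite inE => i _ /=.
  move: (hB i isT); rewrite gB indicE; case: (boolP (_ \in _)); last by rewrite eqxx.
  by rewrite inE.
(* Coordinate [i0] is isolated and the other factors form the weight [W]. The weighted identity for
   indicators of [Z i0] is then the induction hypothesis for [J] without [i0]. *)
pose W w := \prod_(i < n | i != i0) g i (Z i w).
pose c := (\prod_(i < n | i != i0) \int[Pr]_w (g i (Z i w))%:E)%E.
have ige0 i : (0 <= \int[Pr]_w (g i (Z i w))%:E)%E.
  by apply: integral_ge0 => w _; rewrite lee_fin.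
have -> : (\int[Pr]_w (\prod_(i < n) g i (Z i w))%:E =
          \int[Pr]_w (W w * g i0 (Z i0 w))%:E)%E.
  by apply: eq_integral => w _; rewrite (bigD1 i0)//= mulrC.
rewrite [RHS](bigD1 i0)//= muleC; apply: integral_weighted_comp => //.
- rewrite /W; under eq_fun do rewrite big_mkcond.
  apply: measurable_prod => i _; case: (i != i0); first exact: measurableT_comp.
  exact: measurable_cst.
- by move=> w; apply: prodr_ge0 => i _.
- by apply: (big_ind (fun x : \bar R => 0 <= x)%E) => //; exact: mule_ge0.
- apply: (big_ind (fun x : \bar R => x \is a fin_num)) => //; first by move=> x y; exact: fin_numM.
  by move=> i _; rewrite ge0_fin_numE.
move=> B mB.
pose g' i := if i == i0 then \1_B else g i.
have Pg' : P g'.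
  split=> i.
  - rewrite /g'; case: eqP => // _; exact: measurable_indic.
  - by move=> u; rewrite /g'; case: eqP.
  - rewrite /g'; case: eqP => // _; rewrite intB//.
    by rewrite (le_lt_trans (probability_le1 _ _)) ?ltry //; exact: mpre.
have Jk' : (#|(J :\ i0)%SET| < k)%N by move: Jk; rewrite (cardsD1 i0) i0J ltnS.
have gJ' i : i \notin (J :\ i0)%SET -> exists2 B, measurable B & g' i = \1_B.
  rewrite !inE negb_and negbK /g' => /orP[/eqP->|iJ].
    by exists B => //; rewrite eqxx.
  by case: eqP => _; [exists B|exact: gJ].
have := IH _ Jk' g' Pg' gJ'.
rewrite [X in _ = X -> _](bigD1 i0)//= {2}/g' eqxx intB// muleC.
rewrite (eq_bigr (fun i => (\int[Pr]_w (g i (Z i w))%:E)%E)); last first.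
  by move=> i ii0; rewrite /g' (negbTE ii0).
move=> <-.
apply: eq_integral => w _; rewrite [in RHS](bigD1 i0)//= {1}/g' eqxx mulrC.
  by congr (_ * _)%:E; apply: eq_bigr => i ii0; rewrite /g' (negbTE ii0).
Qed.
End independence.

(** * Exponential moments from bounds on the absolute moments *)

Definition exp_tail (R : realType) (N : nat) (u : R) : R :=
  \sum_(k < N) u ^+ k.+2 / k.+2`!%:R.

Lemma cvg_exp_tail (R : realType) (u : R) :
  exp_tail N u @[N --> \oo] --> expR u - 1 - u.
Proof.
have H : series (exp_coeff u) N.+2 @[N --> \oo] --> expR u.
  rewrite (@cvg_shiftS _ (fun N => series (exp_coeff u) N.+1)) cvg_shiftS.
  exact: is_cvg_series_exp_coeff.
have -> : (fun N => exp_tail N u) = (fun N => series (exp_coeff u) N.+2 - 1 - u).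
  apply/funext => N.
  have -> : series (exp_coeff u) N.+2 = 1 + (u + exp_tail N u).
    rewrite /series /= big_mkord !big_ord_recl /exp_coeff /=.
    by rewrite expr0 expr1 !divr1.
  by ring.
by apply: cvgB; [apply: cvgB => //; exact: cvg_cst|exact: cvg_cst].
Qed.

(** The Taylor series beyond order one are compared term by term, by [x^k <= |x|^k]. *)
Lemma expR_le_tail (R : realType) (x : R) :
  expR x <= 1 + x + (expR `|x| - 1 - `|x|).
Proof.
suff : expR x - 1 - x <= expR `|x| - 1 - `|x| by lra.
apply: (ler_cvg_to (@cvg_exp_tail R x) (@cvg_exp_tail R `|x|)).
apply: nearW => N; apply: ler_sum => k _; rewrite ler_wpM2r//.
by rewrite -normrX ler_norm.
Qed.

Lemma exp_tail_ge0 (R : realType) (u : R) N : 0 <= u -> 0 <= exp_tail N u.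
Proof. by move=> u0; apply: sumr_ge0 => k _; rewrite divr_ge0// exprn_ge0. Qed.

Lemma le_exp_tail (R : realType) (u : R) : 0 <= u ->
  nondecreasing_seq (fun N => exp_tail N u).
Proof.
move=> u0; apply/nondecreasing_seqP => N; rewrite /exp_tail big_ord_recr/= lerDl.
by rewrite divr_ge0// exprn_ge0.
Qed.

Section mgf.
Context d (T : measurableType d) (R : realType) (Pr : probability T R).
Local Open Scope ereal_scope.

(** The linear term of [expR_le_tail] integrates to zero because [X] is centred. *)
Lemma integral_expR_le (X : T -> R) : measurable_fun setT X ->
  Pr.-integrable setT (EFin \o X) -> \int[Pr]_w (X w)%:E = 0 ->
  \int[Pr]_w (expR `|X w| - 1 - `|X w|)%:E < +oo ->
  \int[Pr]_w (expR (X w))%:E <=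
    1 + \int[Pr]_w (expR `|X w| - 1 - `|X w|)%:E.
Proof.
move=> mX iX X0 fin.
have mphi : measurable_fun setT (fun w => expR `|X w| - 1 - `|X w|)%R.
  apply: measurable_funB; last exact: measurableT_comp.
  by apply: measurable_funB => //; do 2 apply: measurableT_comp => //.
have phi0 w : (0 <= expR `|X w| - 1 - `|X w|)%R.
  by have := expR_ge1Dx `|X w|; lra.
have iphi : Pr.-integrable setT (fun w => (expR `|X w| - 1 - `|X w|)%:E).
  apply/integrableP; split; first exact/measurable_EFinP.
  by under eq_integral do rewrite gee0_abs ?lee_fin//.
have i1 : Pr.-integrable setT (cst 1).
  by apply: finite_measure_integrable_cst.
have i1X : Pr.-integrable setT (fun w => 1 + (X w)%:E) by exact: integrableD.
have -> : 1 + \int[Pr]_w (expR `|X w| - 1 - `|X w|)%:E =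
   \int[Pr]_w (1 + (X w)%:E + (expR `|X w| - 1 - `|X w|)%:E).
  rewrite integralD// integralD// X0 integral_cst//.
  rewrite [X in 1 * X](@probability_setT _ _ _ Pr).
  by rewrite mul1e adde0.
apply: ge0_le_integral => //.
- by apply/measurable_EFinP; exact: measurableT_comp.
- by apply: emeasurable_funD; [exact: measurable_int i1X|exact: measurable_int iphi].
- by move=> w _; rewrite -!EFinD lee_fin expR_le_tail.
Qed.

(** Expand [exp u - 1 - u] in its power series and exchange sum and integral by monotone
    convergence. The factorials cancel against those of the moment bounds, which leaves the partial
    geometric sums bounded by [v]. *)
Lemma sum_integral_exp_tail_le (n : nat) (X : 'I_n -> T -> R) (rho s2 v : R) :
  (forall i, measurable_fun setT (X i)) ->
  (forall m, (2 <= m)%N -> \sum_(i < n) \int[Pr]_w (`|X i w| ^+ m)%:E <=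
    (n%:R * (m`!%:R / 2 * rho ^+ (m - 2) * s2))%:E) ->
  (forall N, s2 / 2 * \sum_(k < N) rho ^+ k <= v)%R ->
  \sum_(i < n) \int[Pr]_w (expR `|X i w| - 1 - `|X i w|)%:E <= (n%:R * v)%:E.
Proof.
move=> mX hm hv.
have mT N i : measurable_fun setT (fun w => exp_tail N `|X i w|).
  apply: measurable_sum => k; apply: measurable_funM => //.
  by apply: measurable_funX; exact: measurableT_comp.
have mT0 N : measurable_fun setT (fun w => (\sum_(i < n) exp_tail N `|X i w|)%:E).
  by apply/measurable_EFinP/measurable_sum.
have phi0 u : (0 <= u -> 0 <= expR u - 1 - u :> R)%R.
  by have := expR_ge1Dx u; lra.
have mphi i : measurable_fun setT (fun w => expR `|X i w| - 1 - `|X i w|)%R.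
  apply: measurable_funB; last exact: measurableT_comp.
  by apply: measurable_funB => //; do 2 apply: measurableT_comp => //.
have -> : \sum_(i < n) \int[Pr]_w (expR `|X i w| - 1 - `|X i w|)%:E =
   \int[Pr]_w limn (fun N => (\sum_(i < n) exp_tail N `|X i w|)%:E).
  rewrite -ge0_integral_sum//; last 2 first.
  - by move=> i; exact/measurable_EFinP.
  - by move=> i w _; rewrite lee_fin phi0.
  apply: eq_integral => w _; apply/esym/cvg_lim => //.
  under eq_fun do rewrite -sumEFin.
  apply: cvg_nnesum => i _; first by apply: nearW => N; rewrite lee_fin exp_tail_ge0.
  by apply: cvg_EFin; [exact: nearW|exact: cvg_exp_tail].
rewrite monotone_convergence//; last 2 first.
- by move=> N w _; rewrite lee_fin sumr_ge0// => i _; rewrite exp_tail_ge0.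
- move=> w _ a b ab; rewrite lee_fin; apply: ler_sum => i _.
  exact: le_exp_tail.
apply: lime_le.
  apply: ereal_nondecreasing_is_cvgn => a b ab; apply: ge0_le_integral => //.
  - by move=> w _; rewrite lee_fin sumr_ge0// => i _; rewrite exp_tail_ge0.
  - move=> w _; rewrite lee_fin; apply: ler_sum => i _.
    exact: le_exp_tail.
apply: nearW => N.
have -> : \int[Pr]_w (\sum_(i < n) exp_tail N `|X i w|)%:E =
  \sum_(k < N) (k.+2`!%:R^-1)%:E * \sum_(i < n) \int[Pr]_w (`|X i w| ^+ k.+2)%:E.
  have mXk k i : measurable_fun setT (fun w => (`|X i w| ^+ k)%:E).
    by apply/measurable_EFinP/measurable_funX; exact: measurableT_comp.
  under eq_integral do rewrite exchange_big /= -sumEFin.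
  rewrite ge0_integral_sum//; last 2 first.
  - move=> k; apply/measurable_EFinP/measurable_sum => i.
    by apply: measurable_funM => //; apply: measurable_funX; exact: measurableT_comp.
  - by move=> k w _; rewrite lee_fin sumr_ge0// => i _; rewrite divr_ge0// exprn_ge0.
  apply: eq_bigr => k _; rewrite -ge0_integral_sum//.
  rewrite -ge0_integralZl//.
  - apply: eq_integral => w _; rewrite sumEFin -EFinM mulr_sumr; congr EFin.
    by apply: eq_bigr => i _; rewrite mulrC.
  - exact: emeasurable_sum.
  - by move=> w _; apply: sume_ge0 => i _; rewrite lee_fin; exact: exprn_ge0.
apply: (@le_trans _ _ (\sum_(k < N) (k.+2`!%:R^-1 * (n%:R * (k.+2`!%:R / 2 * rho ^+ k * s2)))%:E)).
  apply: lee_sum => k _; rewrite EFinM lee_wpmul2l ?lee_fin ?invr_ge0//.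
  by have := hm k.+2 isT; rewrite subSS subSS subn0.
rewrite sumEFin lee_fin.
have -> : (\sum_(k < N) k.+2`!%:R^-1 * (n%:R * (k.+2`!%:R / 2 * rho ^+ k * s2)) =
   n%:R * (s2 / 2 * \sum_(k < N) rho ^+ k))%R.
  rewrite !mulr_sumr; apply: eq_bigr => k _.
  have : (k.+2`!%:R != 0 :> R)%R by rewrite pnatr_eq0 -lt0n fact_gt0.
  by move=> ?; field.
by rewrite ler_wpM2l.
Qed.

End mgf.

(** * Bernstein's exponential inequality for independent summands *)

Section bernstein.
Context d d' (T : measurableType d) (U : measurableType d') (R : realType)
  (Pr : probability T R) (n : nat) (Z : 'I_n -> {RV Pr >-> U}).
Local Open Scope ereal_scope.

(** Independence factors the integral, and each factor is at most [1 + e i <= exp (e i)]. *)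
Lemma integral_expR_sum_le (h : 'I_n -> U -> R) (b : R) :
  mutually_independent Z ->
  (forall i, measurable_fun setT (h i)) ->
  (forall i, Pr.-integrable setT (EFin \o (h i \o Z i))) ->
  (forall i, \int[Pr]_w (h i (Z i w))%:E = 0) ->
  \sum_(i < n) \int[Pr]_w (expR `|h i (Z i w)| - 1 - `|h i (Z i w)|)%:E <= b%:E ->
  \int[Pr]_w (expR (\sum_(i < n) h i (Z i w)))%:E <= (expR b)%:E.
Proof.
move=> indZ mh ih h0.
pose e i := \int[Pr]_w (expR `|h i (Z i w)| - 1 - `|h i (Z i w)|)%:E.
have e0 i : 0 <= e i.
  by apply: integral_ge0 => w _; rewrite lee_fin; have := expR_ge1Dx `|h i (Z i w)|; lra.
rewrite -/(\sum_(i < n) e i) => eb.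
have efin i : e i \is a fin_num.
  rewrite ge0_fin_numE//; apply: (@le_lt_trans _ _ b%:E); last exact: ltry.
  by apply: le_trans eb; rewrite (bigD1 i)//= leeDl// sume_ge0.
have mgf i : \int[Pr]_w (expR (h i (Z i w)))%:E <= 1 + e i.
  apply: (@integral_expR_le _ _ _ _ (h i \o Z i)) => //.
  - exact: measurableT_comp.
  - exact: h0.
  - by rewrite ltey_eq efin.
have -> : \int[Pr]_w (expR (\sum_(i < n) h i (Z i w)))%:E =
   \int[Pr]_w (\prod_(i < n) expR (h i (Z i w)))%:E.
  by apply: eq_integral => w _; rewrite expR_sum.
rewrite (integral_prod_indep (g := fun i => expR \o h i))//; last first.
- move=> i; apply: (le_lt_trans (mgf i)).
  by rewrite -(fineK (efin i)) -EFinD ltry.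
- by move=> i u; exact: expR_ge0.
- by move=> i; exact: measurableT_comp.
apply: (@le_trans _ _ (\prod_(i < n) (expR (fine (e i)))%:E)).
  (* Nonnegativity is carried along because multiplying inequalities requires it. *)
  pose K (x y : \bar R) := 0 <= x /\ x <= y.
  suff [] : K (\prod_(i < n) \int[Pr]_w (expR (h i (Z i w)))%:E)
    (\prod_(i < n) (expR (fine (e i)))%:E) by [].
  apply: (big_ind2 K) => [|x1 x2 y1 y2 [? ?] [? ?]|i _]; split => //.
  - exact: mule_ge0.
  - exact: lee_pmul.
  - by apply: integral_ge0 => w _; rewrite lee_fin expR_ge0.
  - apply: (le_trans (mgf i)); rewrite -(fineK (efin i)) -EFinD lee_fin.
    exact: expR_ge1Dx.
rewrite prodEFin lee_fin -expR_sum ler_expR -lee_fin -sumEFin.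
by under eq_bigr do rewrite fineK//.
Qed.

(** The multiplier [lam = D / (g sqrt D + 2 K D)] makes the geometric ratio [2 K lam] at most 1, and
    [lam^2 g^2 / (2 (1 - 2 K lam))] at most [D / 2] when [g > 0]. *)
Lemma bernstein_expR_le (h : 'I_n -> U -> R) (K D g delta : R) :
  (0 < n)%N -> mutually_independent Z ->
  (forall i, measurable_fun setT (h i)) ->
  (forall i, Pr.-integrable setT (EFin \o (h i \o Z i))) ->
  (forall i, \int[Pr]_w (h i (Z i w))%:E = 0) ->
  (0 < K)%R -> (0 < D)%R -> (0 <= delta)%R -> (delta <= g)%R ->
  (forall m, (2 <= m)%N ->
     mean_expectation Pr (fun i w => `|h i (Z i w)| ^+ m)%R <=
     (m`!%:R / 2 * (2 * K) ^+ (m - 2) * delta ^+ 2)%:E) ->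
  \int[Pr]_w (expR (D / (g * Num.sqrt D + 2 * K * D) *
                    \sum_(i < n) h i (Z i w)))%:E <= (expR (n%:R * D / 2))%:E.
Proof.
move=> n0 indZ mh ih h0 K0 D0 del0 delg hm.
set a := (g * _ + _)%R; set lam := (D / a)%R.
have sD : (0 < Num.sqrt D)%R by rewrite sqrtr_gt0.
have g0 : (0 <= g)%R by exact: le_trans delg.
have KD0 : (0 < 2 * K * D)%R by rewrite !mulr_gt0.
have gs0 : (0 <= g * Num.sqrt D)%R by rewrite mulr_ge0// ltW.
have a0 : (0 < a)%R by rewrite /a; lra.
have lam0 : (0 < lam)%R by rewrite divr_gt0.
have n0R : (0 < n%:R :> R)%R by rewrite ltr0n.
under eq_integral do rewrite mulr_sumr.
apply: (@integral_expR_sum_le (fun i u => lam * h i u)%R) => //.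
- by move=> i; exact: measurable_funM.
- move=> i; have := integrableZl measurableT lam (ih i).
  by apply: eq_integrable => // w _; rewrite /= EFinM.
- move=> i; under eq_integral do rewrite EFinM.
  by rewrite integralZl// ?h0 ?mule0//; exact: ih.
rewrite -mulrA.
apply: (@sum_integral_exp_tail_le _ _ _ _ _ (fun i w => lam * h i (Z i w))%R
  (2 * K * lam) (lam ^+ 2 * delta ^+ 2)).
- by move=> i; apply: measurable_funM => //; exact: measurableT_comp.
- move=> m m2.
  have mXm i : measurable_fun setT (fun w => (`|h i (Z i w)| ^+ m)%:E).
    by apply/measurable_EFinP/measurable_funX; do 2 apply: measurableT_comp => //.
  have -> : \sum_(i < n) \int[Pr]_w (`|lam * h i (Z i w)| ^+ m)%:E =
     (lam ^+ m)%:E * \sum_(i < n) \int[Pr]_w (`|h i (Z i w)| ^+ m)%:E.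
    rewrite ge0_sume_distrr; last first.
      by move=> i _; apply: integral_ge0 => w _; rewrite lee_fin exprn_ge0.
    apply: eq_bigr => i _; rewrite -ge0_integralZl//.
    - by apply: eq_integral => w _; rewrite normrM exprMn gtr0_norm// EFinM.
    - by rewrite lee_fin exprn_ge0// ltW.
  have := hm m m2; rewrite /mean_expectation; under eq_bigr do rewrite unlock.
  rewrite -(@lee_pmul2l _ (n%:R * lam ^+ m)%:E)//; last first.
    by rewrite lte_fin mulr_gt0// exprn_gt0.
  rewrite muleA -!EFinM mulrAC mulfV ?gt_eqF// mul1r => /le_trans; apply.
  rewrite lee_fin le_eqVlt; apply/orP; left; apply/eqP.
  have -> : (lam ^+ m = lam ^+ 2 * lam ^+ (m - 2))%R by rewrite -exprD subnKC.
  have -> : ((2 * K * lam) ^+ (m - 2) = (2 * K) ^+ (m - 2) * lam ^+ (m - 2))%R.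
    exact: exprMn.
  by set x := (lam ^+ (m - 2))%R; set y := ((2 * K) ^+ (m - 2))%R; ring.
- move=> N; set S := (\sum_(k < N) _)%R.
  (* [hh] is the sub-Gaussian share of [a]: the moment series is geometric of
     ratio [1 - hh], with a prefactor at most [D hh^2 / 2]. *)
  pose hh : R := (g * Num.sqrt D / a)%R.
  have hh0 : (0 <= hh)%R by rewrite divr_ge0// ltW.
  have hh1 : (hh <= 1)%R by rewrite ler_pdivrMr// /a; lra.
  have rho : (2 * K * lam = 1 - hh)%R.
    by rewrite /hh /lam /a; field; rewrite gt_eqF.
  have S0 : (0 <= S)%R.
    by apply: sumr_ge0 => k _; rewrite exprn_ge0// rho; lra.
  (* Stated as a product, not as [S <= 1 / hh], to cover [g = 0]: there [hh = 0], the ratio is 1 and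
     [S = N] is unbounded. *)
  have hS : (hh * S <= 1)%R.
    have := subrX1 (2 * K * lam)%R N; rewrite -/S rho => HS.
    have : (0 <= (1 - hh) ^+ N)%R by rewrite exprn_ge0//; lra.
    have -> : (hh * S = 1 - (1 - hh) ^+ N)%R by lra.
    lra.
  have lg : (lam ^+ 2 * delta ^+ 2 <= D * hh ^+ 2)%R.
    apply: (@le_trans _ _ (lam ^+ 2 * g ^+ 2)%R).
      by rewrite ler_wpM2l ?sqr_ge0// ler_pXn2r.
    rewrite /hh /lam !expr_div_n exprMn sqr_sqrtr ?(ltW D0)//.
    by rewrite le_eqVlt; apply/orP; left; apply/eqP; field; rewrite gt_eqF.
  apply: (@le_trans _ _ (D * hh ^+ 2 / 2 * S)%R).
    by rewrite ler_wpM2r// ler_wpM2r.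
  have -> : (D * hh ^+ 2 / 2 * S = D / 2 * (hh * (hh * S)))%R by ring.
  rewrite ler_piMr ?divr_ge0 ?(ltW D0)// mulr_ile1// mulr_ge0//.
Qed.

End bernstein.

(** * Inverting the inequality between excess risks for their roots *)

Section excess.
Context (R : realType) (kappa : R).
Context (kappa_ge1 : 1 <= kappa).
Let q : R := (2 * kappa)^-1.
Let r : R := (2 * kappa - 1)^-1.
Let s1 : 1 <= 2 * kappa - 1. Proof. by have := kappa_ge1; lra. Qed.

Lemma powR_invK (e : R) : 0 <= e -> (e `^ q) `^ (2 * kappa - 1 + 1) = e.
Proof.
by move=> e0; rewrite subrK -powRrM mulVf ?powRr1//; have := kappa_ge1; lra.
Qed.

Lemma powR_rK (e : R) : 0 <= e -> (e `^ r) `^ (2 * kappa - 1) = e.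
Proof.
by move=> e0; rewrite -powRrM mulVf ?powRr1//; have := s1; lra.
Qed.

Lemma ge_mul_powR_r (a b u : R) : 1 <= a -> 0 <= b -> 0 <= u ->
  u * b <= (a * b `^ r * u `^ r) `^ (2 * kappa - 1).
Proof.
move=> a1 b0 u0; have a0 : 0 <= a by lra.
rewrite !powRM ?mulr_ge0 ?powR_ge0// !powR_rK// [leLHS]mulrC.
rewrite ler_wpM2r// ler_peMl//.
rewrite -[leLHS](@powRr0 R a) ler_powR//; have := s1; lra.
Qed.

Section increment.
Context (a b u e0 e : R).
Context (a1 : 1 <= a) (b0 : 0 <= b) (u0 : 0 <= u) (e0_ge0 : 0 <= e0)
  (e_ge0 : 0 <= e).
Let x := e `^ q.
Let y := e0 `^ q.
Let w := a * b `^ r * u `^ r.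
Let x0 : 0 <= x. Proof. exact: powR_ge0. Qed.
Let y0 : 0 <= y. Proof. exact: powR_ge0. Qed.
Let w0 : 0 <= w.
Proof. by rewrite !mulr_ge0 ?powR_ge0//; have := a1; lra. Qed.

(** This is [powR_increment_ge] with [u b] as a lower bound for the power of [w]. The tail bounds
    take [u = 1]; the moment bounds take for [u] the normalised deviation. The last product is kept
    for the strict gain in [root_excess_le]. *)
Lemma excess_increment_ge : y + w <= x -> u * b * (x + y) +
    x `^ (2 * kappa - 1 - 1) * (x + y) * (x - y - w) <= e - e0.
Proof.
move=> /(powR_increment_ge s1 y0 w0); rewrite /x /y !powR_invK// -/x -/y.
apply: le_trans; rewrite lerD2r ler_wpM2r ?ge_mul_powR_r//.
by rewrite addr_ge0.
Qed.

Lemma excess_ge : y + w <= x -> u * b * (x + y) <= e - e0.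
Proof.
move=> h; apply: le_trans (excess_increment_ge h); rewrite lerDl.
by rewrite !mulr_ge0 ?powR_ge0 ?(addr_ge0 x0 y0)//; move: h; lra.
Qed.

(** If [x > y + w], the extra product in [excess_increment_ge] is positive and contradicts the
    hypothesis. *)
Lemma root_excess_le : e - e0 <= u * b * (x + y) -> x <= y + w.
Proof.
move=> h; rewrite leNgt; apply/negP => lt.
have xp : 0 < x by have := y0; have := w0; move: lt; lra.
have := excess_increment_ge (ltW lt); apply/negP; rewrite -ltNge.
apply: le_lt_trans h _; rewrite ltrDl mulr_gt0 ?subr_gt0//; last first.
  by rewrite ltrBrDl.
by rewrite (mulr_gt0 (powR_gt0 _ xp))// ltr_wpDr.
Qed.

Context (z : R).
Context (e0z : e0 <= z).

Let yz : y <= z `^ q.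
Proof.
apply: ge0_ler_powR; rewrite ?nnegrE ?(le_trans e0_ge0 e0z)//.
by rewrite /q invr_ge0; have := kappa_ge1; lra.
Qed.

Let z0 : 0 <= z. Proof. exact: le_trans e0z. Qed.

(** Here [c = u^r] in [powR_increment_ge_small], so [2 c^s z^(s+1)] becomes [2 u z] with [z] in the
    role of its root. With [z = K D] this accounts for the linear Bernstein term without dividing by
    [y], which may vanish. *)
Lemma excess_increment_ge_small : w + z `^ q * (1 + u `^ r) <= x ->
  u * (b * (x + y) + 2 * z) + x `^ (2 * kappa - 1 - 1) * (x + z `^ q) *
     (x - w - z `^ q * (1 + u `^ r)) <= e - e0.
Proof.
move=> /(powR_increment_ge_small s1 y0 yz w0 (powR_ge0 _ _)).
rewrite powR_rK// /x /y !powR_invK// -/x -/y.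
apply: le_trans; rewrite lerD2r.
have -> : u * (b * (x + y) + 2 * z) = u * b * (x + y) + 2 * u * z by ring.
by rewrite lerD2r ler_wpM2r ?ge_mul_powR_r// addr_ge0.
Qed.

Lemma excess_ge_small : w + z `^ q * (1 + u `^ r) <= x ->
  u * (b * (x + y) + 2 * z) <= e - e0.
Proof.
move=> h; apply: le_trans (excess_increment_ge_small h); rewrite lerDl.
by rewrite !mulr_ge0 ?powR_ge0 ?(addr_ge0 x0 (powR_ge0 z q))//; move: h; lra.
Qed.

Lemma root_excess_le_small : e - e0 <= u * (b * (x + y) + 2 * z) ->
  x <= w + z `^ q * (1 + u `^ r).
Proof.
move=> h; rewrite leNgt; apply/negP => lt.
have zu : 0 <= z `^ q * (1 + u `^ r).
  by rewrite mulr_ge0 ?addr_ge0 ?powR_ge0.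
have xp : 0 < x by have := w0; move: lt; lra.
have := excess_increment_ge_small (ltW lt); apply/negP; rewrite -ltNge.
apply: le_lt_trans h _; rewrite ltrDl mulr_gt0 ?subr_gt0//; last first.
  by rewrite ltrBrDl.
by rewrite (mulr_gt0 (powR_gt0 _ xp))// ltr_wpDr// powR_ge0.
Qed.

End increment.
End excess.

(** * Random indices and finite families with bounded exponential moments *)

Lemma measurable_preimage_ord d (T : measurableType d) (p : nat)
    (jhat : T -> 'I_p) (B : set 'I_p) :
  (forall j, measurable (jhat @^-1` [set j])) -> measurable (jhat @^-1` B).
Proof.
move=> mj; have -> : jhat @^-1` B = \bigcup_(j in B) jhat @^-1` [set j].
  apply/seteqP; split => [w Bw|w [j Bj] /= ->//]; by exists (jhat w).
by apply: fin_bigcup_measurable => // ; exact: finite_finset.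
Qed.

Lemma measurable_fun_comp_ord d (T : measurableType d) (R : realType) (p : nat)
    (jhat : T -> 'I_p) (f : 'I_p -> R) :
  (forall j, measurable (jhat @^-1` [set j])) ->
  measurable_fun setT (fun w => f (jhat w)).
Proof.
by move=> mj _ B mB; rewrite setTI; exact: (measurable_preimage_ord (f @^-1` B)).
Qed.

Section exponential_family.
Context d (T : measurableType d) (R : realType) (Pr : probability T R) (p : nat)
  (S : 'I_p -> T -> R) (b : R).
Context (mS : forall j, measurable_fun setT (S j))
  (expS : forall j,
    (\int[Pr]_w (expR (S j w))%:E <= (expR (b / 2))%:E)%E).

Let mexpS (j : 'I_p) : measurable_fun setT (fun w => (expR (S j w))%:E).
Proof. by apply/measurable_EFinP; exact: measurableT_comp. Qed.

Lemma integral_sum_expR_le (c : R) : 0 <= c ->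
  (\int[Pr]_w (c * \sum_(j < p) expR (S j w))%:E <=
    (c * (p%:R * expR (b / 2)))%:E)%E.
Proof.
move=> c0; under eq_integral do rewrite EFinM -sumEFin.
rewrite ge0_integralZl//; last 2 first.
- exact: emeasurable_sum.
- by move=> w _; apply: sume_ge0 => j _; rewrite lee_fin expR_ge0.
rewrite ge0_integral_sum//.
rewrite EFinM lee_wpmul2l ?lee_fin//.
apply: (@le_trans _ _ (\sum_(j < p) (expR (b / 2))%:E)%E).
  by apply: lee_sum => j _.
by rewrite sumEFin sumr_const card_ord mulr_natl.
Qed.

(** Markov's inequality for the sum of the exponentials: on [E] the function
    [exp(-b) sum_j exp(S_j)] is at least 1, and its mean is at most [exp(-b) p exp(b/2)]. *)
Lemma union_chernoff (E : set T) : measurable E ->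
  (forall w, E w -> exists j, b <= S j w) ->
  (Pr E <= (p%:R * expR (- b / 2))%:E)%E.
Proof.
move=> mE hE.
have -> : Pr E = (\int[Pr]_w (\1_E w)%:E)%E.
  by rewrite (integral_indic Pr measurableT)// setIT.
apply: (@le_trans _ _ (\int[Pr]_w (expR (- b) * \sum_(j < p) expR (S j w))%:E)%E).
  apply: ge0_le_integral => //.
  - by apply/measurable_EFinP; exact: measurable_indic.
  - apply/measurable_EFinP; apply: measurable_funM => //; apply: measurable_sum => j.
    exact: measurableT_comp.
  - move=> w _; rewrite lee_fin indicE; case: (boolP (w \in E)) => [|_]; last first.
      by rewrite mulr_ge0 ?expR_ge0// sumr_ge0// => j _; rewrite expR_ge0.
    rewrite inE => /hE[j bS]; rewrite (bigD1 j)//= mulrDr -expRD.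
    apply: (@le_trans _ _ (expR (- b + S j w))).
      by rewrite -(@expR0 R) ler_expR; lra.
    by rewrite lerDl mulr_ge0 ?expR_ge0// sumr_ge0// => k _; rewrite expR_ge0.
apply: (le_trans (integral_sum_expR_le (expR_ge0 (- b)))).
rewrite lee_fin mulrCA -expRD.
by have -> : - b + b / 2 = - b / 2 by lra.
Qed.

(** The mean of [1 + sum_j exp(S_j)] is at most [1 + p exp(b/2) <= exp b], so the factor of [X^m]
    has mean at most 1. The leading 1 stands for the exponential of a deviation truncated at
    zero. *)
Lemma Lnorm_le_expR (f : T -> R) (X theta m : R) :
  1 <= m -> measurable_fun setT f -> (forall w, 0 <= f w) -> 0 <= X ->
  0 <= theta <= 1 ->
  1 + p%:R * expR (b / 2) <= expR b ->
  (forall w, f w `^ m <= X `^ m *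
     (1 + theta * (expR (- b) * (1 + \sum_(j < p) expR (S j w)) - 1))) ->
  ('N[Pr]_(m%:E)[(fun w => (f w)%:E)] <= X%:E)%E.
Proof.
move=> m1 mf f0 X0 /andP[t0 t1] hb hf.
rewrite unlock /Lnorm.
have m0 : 0 < m by lra.
(* Writing [X] as [(X^m)^(1/m)] reduces the claim to a bound on the integral of [f^m]. *)
rewrite -[leRHS](poweRe1 (x := X%:E)) ?lee_fin//.
rewrite -[X in (_ <= _ `^ X)%E](mulfV (lt0r_neq0 m0)) poweRrM.
rewrite gt0_ler_poweR ?invr_ge0 ?(ltW m0)//.
- by rewrite in_itv/= leey andbT integral_ge0// => w _; exact: poweR_ge0.
- by rewrite in_itv/= leey andbT ?lee_fin ?powR_ge0.
rewrite poweR_EFin.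
pose u := X `^ m * (1 - theta + theta * expR (- b)).
pose v := X `^ m * theta * expR (- b).
have v0 : 0 <= v by rewrite /v !mulr_ge0 ?powR_ge0 ?expR_ge0.
have u0 : 0 <= u.
  by rewrite /u mulr_ge0 ?powR_ge0// addr_ge0 ?mulr_ge0 ?expR_ge0//; lra.
have mv : measurable_fun setT (fun w => (v * \sum_(j < p) expR (S j w))%:E).
  apply/measurable_EFinP; apply: measurable_funM => //; apply: measurable_sum => j.
  exact: measurableT_comp.
have v0' w : (0 <= (v * \sum_(j < p) expR (S j w))%:E)%E.
  by rewrite lee_fin mulr_ge0// sumr_ge0// => j _; rewrite expR_ge0.
apply: (@le_trans _ _ (\int[Pr]_w (u%:E + (v * \sum_(j < p) expR (S j w))%:E))%E).
  apply: ge0_le_integral => //.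
  - by move=> w _; exact: poweR_ge0.
  - under eq_fun do rewrite /=.
    apply/measurable_EFinP; apply: (measurableT_comp (measurable_powR m)).
    exact: measurableT_comp.
  - exact: emeasurable_funD.
  - move=> w _; rewrite /= ger0_norm// -EFinD lee_fin.
    apply: (le_trans (hf w)); rewrite le_eqVlt; apply/orP; left; apply/eqP.
    by rewrite /u /v; ring.
rewrite ge0_integralD//.
rewrite integral_cst// [X in (_ * X)%E](@probability_setT _ _ _ Pr) mule1.
apply: (le_trans (leeD2l _ (integral_sum_expR_le v0))).
rewrite -EFinD lee_fin /u /v.
have -> : X `^ m * (1 - theta + theta * expR (- b)) +
    X `^ m * theta * expR (- b) * (p%:R * expR (b / 2)) =
  X `^ m * (1 - theta + theta * (expR (- b) * (1 + p%:R * expR (b / 2)))) by ring.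
rewrite ler_piMr ?powR_ge0//.
have : expR (- b) * (1 + p%:R * expR (b / 2)) <= 1.
  apply: (@le_trans _ _ (expR (- b) * expR b)).
    by rewrite ler_wpM2l ?expR_ge0.
  by rewrite -expRD addNr expR0.
move=> /(ler_wpM2l t0); lra.
Qed.

End exponential_family.

(** * Theoretical means, empirical means and their centred differences *)

Section means.
Context d d' (T : measurableType d) (U : measurableType d') (R : realType)
  (Pr : probability T R) (n : nat) (Z : 'I_n -> {RV Pr >-> U}).

Definition integrable_loss (g : U -> R) :=
  forall i, Pr.-integrable setT (EFin \o (g \o Z i)).

Lemma expectation_loss_fin_num g i : integrable_loss g ->
  ('E_Pr[g \o Z i] \is a fin_num)%E.
Proof. by move=> ig; rewrite unlock; exact: integrable_fin_num (ig i). Qed.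

Lemma theoretical_meanE g : integrable_loss g ->
  theoretical_mean Z g = n%:R^-1 * \sum_(i < n) fine 'E_Pr[g \o Z i].
Proof.
move=> ig; rewrite /theoretical_mean /mean_expectation.
under eq_bigr do rewrite -(fineK (expectation_loss_fin_num _ ig)).
by rewrite sumEFin.
Qed.

Lemma theoretical_meanB g h : integrable_loss g -> integrable_loss h ->
  theoretical_mean Z (g \- h) = theoretical_mean Z g - theoretical_mean Z h.
Proof.
move=> ig ih; have igh : integrable_loss (g \- h).
  move=> i; have := integrableB measurableT (ig i) (ih i).
  by apply: eq_integrable => // w _; rewrite /= EFinB.
rewrite !theoretical_meanE// -mulrBr -sumrB; congr (_ * _).
apply: eq_bigr => i _; rewrite -fineB ?expectation_loss_fin_num//.
congr fine; rewrite unlock.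
under eq_integral do rewrite /= EFinB.
by rewrite integralB//; [exact: ig|exact: ih].
Qed.

(** Unnormalised: [n] times the centred empirical mean of [h - g], the form to which the Bernstein
    bound applies. *)
Definition centered_gap (g h : U -> R) (w : T) : R :=
  \sum_(i < n) (centered Pr (h \o Z i) w - centered Pr (g \o Z i) w).

(** When [g] has the smaller empirical mean, this bounds the theoretical mean of [g] minus that of
    [h] by the normalised gap. *)
Lemma centered_gapE g h w : integrable_loss g -> integrable_loss h ->
  n%:R^-1 * centered_gap g h w =
  empirical_mean Z h w - empirical_mean Z g w +
  (theoretical_mean Z g - theoretical_mean Z h).
Proof.
move=> ig ih; rewrite !theoretical_meanE// /empirical_mean -!mulrBr -mulrDr.
by rewrite -!sumrB -big_split; congr (_ * _); apply: eq_bigr => i _ /=;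
  rewrite /centered /=; ring.
Qed.

Lemma measurable_centered_gap g h : measurable_fun setT g ->
  measurable_fun setT h -> measurable_fun setT (centered_gap g h).
Proof.
move=> mg mh; apply: measurable_sum => i.
by apply: measurable_funB; apply: measurable_funB => //; exact: measurableT_comp.
Qed.

Lemma integral_expR_centered_gap_le g h (K D G delta : R) :
  (0 < n)%N -> mutually_independent Z ->
  measurable_fun setT g -> measurable_fun setT h ->
  integrable_loss g -> integrable_loss h ->
  0 < K -> 0 < D -> 0 <= delta -> delta <= G ->
  (forall m, (2 <= m)%N -> (centered_moment Z g h m <=
     (m`!%:R / 2 * (2 * K) ^+ (m - 2) * delta ^+ 2)%:E)%E) ->
  (\int[Pr]_w (expR (D / (G * Num.sqrt D + 2 * K * D) *
                    centered_gap g h w))%:E <= (expR (n%:R * D / 2))%:E)%E.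
Proof.
move=> n0 indZ mg mh ig ih K0 D0 de0 deG hm.
have icst (c : R) : Pr.-integrable setT (EFin \o cst c).
  exact: finite_measure_integrable_cst.
have icen f i : integrable_loss f ->
    Pr.-integrable setT (EFin \o centered Pr (f \o Z i)).
  move=> ifm; have := integrableB measurableT (ifm i) (icst (fine 'E_Pr[f \o Z i])).
  by apply: eq_integrable => // w _; rewrite /= EFinB.
have cen0 f i : integrable_loss f ->
    (\int[Pr]_w (centered Pr (f \o Z i) w)%:E = 0)%E.
  move=> ifm; rewrite /centered; under eq_integral do rewrite EFinB.
  rewrite integralB//; last exact: (icst _).
    rewrite integral_cst// [X in (_ * X)%E](@probability_setT _ _ _ Pr) mule1.
    rewrite fineK; last exact: expectation_loss_fin_num.
    rewrite unlock subee//.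
    by have := expectation_loss_fin_num i ifm; rewrite unlock.
  exact: ifm.
apply: (@bernstein_expR_le _ _ _ _ _ _ _ _ (fun i u =>
    (h u - fine 'E_Pr[h \o Z i]) - (g u - fine 'E_Pr[g \o Z i])) K D G delta) => //.
- by move=> i; apply: measurable_funB; apply: measurable_funB.
- move=> i; have := integrableB measurableT (icen h i ih) (icen g i ig).
  by apply: eq_integrable => // w _; rewrite /= -EFinB.
- move=> i.
  under eq_integral do rewrite EFinB.
  by rewrite integralB ?[X in (X - _)%E](cen0 h i ih) ?[X in (_ - X)%E](cen0 g i ig) ?sube0//;
    [exact: (icen h)|exact: (icen g)].
- move=> m m2; apply: le_trans (hm m m2).
  rewrite /centered_moment le_eqVlt; apply/orP; left; apply/eqP.
  congr mean_expectation; apply/funext => i; apply/funext => w.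
  by rewrite distrC.
Qed.

End means.

(** * Tail and moment bounds for the empirical risk minimizer *)

Theorem lemma6p2 (R : realType)
  (dOmega dZ : measure_display)
  (Omega : measurableType dOmega) (Zsp : measurableType dZ)
  (Pr : probability Omega R)
  (* the sample *)
  (n : nat) (n_gt0 : (0 < n)%N)
  (Z : 'I_n -> {RV Pr >-> Zsp})
  (Z_indep : mutually_independent Z)
  (* the class of loss functions, indexed by a subset F of a metric space *)
  (M : metricType R) (F : set M) (gamma : M -> Zsp -> R)
  (gamma_meas : forall f, F f -> measurable_fun setT (gamma f))
  (gamma_int : forall f i, F f ->
     Pr.-integrable setT (EFin \o (gamma f \o Z i)))
  (* the candidates f_1, ..., f_p *)
  (p : nat) (fs : 'I_p -> M) (fs_F : forall j, F (fs j))
  (* the target *)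
  (f0 : M) (f0_F : F f0)
  (f0_min : forall f, F f ->
     theoretical_mean Z (gamma f0) <= theoretical_mean Z (gamma f))
  (* the best approximation f_* = fs jstar *)
  (jstar : 'I_p)
  (jstar_min : forall j,
     theoretical_mean Z (gamma (fs jstar)) <=
     theoretical_mean Z (gamma (fs j)))
  (* the (measurable) index selected by empirical risk minimization *)
  (jhat : Omega -> 'I_p)
  (jhat_meas : forall j, measurable (jhat @^-1` [set j]))
  (jhat_min : forall w j,
     empirical_mean Z (gamma (fs (jhat w))) w <=
     empirical_mean Z (gamma (fs j)) w)
  (kappa C K : R)
  (kappa_ge1 : 1 <= kappa) (C_gt0 : 0 < C) (K_gt0 : 0 < K)
  (margin : forall j,
     mdist (fs j) f0 `^ (2 * kappa) / C `^ (2 * kappa) <=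
     theoretical_mean Z (gamma (fs j) \- gamma f0))
  (exp_moment : forall (m : nat) (j : 'I_p), (2 <= m)%N ->
     (centered_moment Z (gamma (fs j)) (gamma (fs jstar)) m <=
      (m`!%:R / 2 * (2 * K) ^+ (m - 2) *
       mdist (fs j) (fs jstar) ^+ 2)%:E)%E) :
  let Ehat : Omega -> R :=
    fun w => theoretical_mean Z (gamma (fs (jhat w)) \- gamma f0) in
  let Estar : R := theoretical_mean Z (gamma (fs jstar) \- gamma f0) in
  let Delta : R := 2 * ln (2 * p%:R) / n%:R in
  let A : R := A_const kappa in
  let q : R := (2 * kappa)^-1 in
  let r : R := (2 * kappa - 1)^-1 in
  [/\ A < 2,
      0 < Estar -> forall t : R, 0 < t ->
        (Pr [set w |
           (Ehat w `^ q >=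
            Estar `^ q +
            A * (C * Num.sqrt (Delta + 2 * t / n%:R) +
                 K * (Delta + 2 * t / n%:R) / Estar `^ q) `^ r)%R]
         <= (expR (- t))%:E)%E,
      forall t : R, 0 < t -> Estar <= K * (Delta + 2 * t / n%:R) ->
        (Pr [set w |
           (Ehat w `^ q >=
            A * (C * Num.sqrt (Delta + 2 * t / n%:R)) `^ r +
            2 * (K * (Delta + 2 * t / n%:R)) `^ q)%R]
         <= (expR (- t))%:E)%E
    & forall m : R, 1 <= m -> m <= (1 + ln p%:R) * (2 * kappa - 1) ->
        (0 < Estar ->
           ('N[Pr]_(m%:E)[(fun w => (Ehat w `^ q)%:E)] <=
            (Estar `^ q +
             A * (C * Num.sqrt Delta + K * Delta / Estar `^ q) `^ r)%:E)%E)
        /\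
        (Estar <= K * Delta ->
           ('N[Pr]_(m%:E)[(fun w => (Ehat w `^ q)%:E)] <=
            (A * (C * Num.sqrt Delta) `^ r +
             2 * (K * Delta) `^ q)%:E)%E)].
Proof.
move=> Ehat Estar Delta A q r.
have s1 : 1 <= 2 * kappa - 1 by lra.
have A1 : 1 <= A by exact: A_const_ge1.
have A0 : 0 < A by exact: lt_le_trans A1.
have n0R : 0 < n%:R :> R by rewrite ltr0n.
have il f : F f -> integrable_loss Z (gamma f) by move=> Ff i; exact: gamma_int.
pose E j := theoretical_mean Z (gamma (fs j) \- gamma f0).
have Edef j : E j = theoretical_mean Z (gamma (fs j)) - theoretical_mean Z (gamma f0).
  by rewrite /E theoretical_meanB//; apply: il.
have E0 j : 0 <= E j.
  by apply: le_trans (margin j); rewrite divr_ge0 ?powR_ge0.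
have EhatE w : Ehat w = E (jhat w) by [].
have EstarE : Estar = E jstar by [].
have Emin j : Estar <= E j by rewrite EstarE !Edef lerD2r.
pose x j := E j `^ q.
pose y := Estar `^ q.
have q0 : 0 <= q by rewrite invr_ge0; lra.
have r0 : 0 <= r by rewrite invr_ge0; lra.
have x0 j : 0 <= x j by exact: powR_ge0.
have y0 : 0 <= y by exact: powR_ge0.
have yx j : y <= x j.
  by apply: ge0_ler_powR; rewrite ?nnegrE// EstarE.
have dist0 j : mdist (fs j) f0 <= C * x j.
  have k0 : 0 < 2 * kappa by lra.
  have := margin j; rewrite -/(E j) ler_pdivrMr ?powR_gt0//.
  have -> : E j = x j `^ (2 * kappa).
    by rewrite /x -powRrM mulVf ?gt_eqF// powRr1.
  rewrite [leRHS]mulrC -powRM ?(ltW C_gt0)// => h; rewrite leNgt; apply/negP => lt.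
  have := gt0_ltr_powR k0 _ _ lt; rewrite !nnegrE mdist_ge0 mulr_ge0 ?(ltW C_gt0)//.
  by move=> /(_ isT isT); rewrite ltNge h.
have distj j : mdist (fs j) (fs jstar) <= C * (x j + y).
  apply: le_trans (metric_triangle _ f0 _) _.
  by rewrite mulrDr lerD// metric_sym; exact: dist0.
pose V j := centered_gap Z (gamma (fs j)) (gamma (fs jstar)).
have mV j : measurable_fun setT (V j).
  by apply: measurable_centered_gap; exact: gamma_meas.
have erm w : Ehat w - Estar <= n%:R^-1 * V (jhat w) w.
  rewrite centered_gapE; [|exact: il..].
  rewrite EhatE EstarE !Edef; have := jhat_min w jstar; lra.
pose a D j := C * Num.sqrt D * (x j + y) + 2 * (K * D).
(* For [D > 0], [S D j] reaches [n D] exactly when the centred mean [V j / n] reaches [a D j]. *)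
pose S D j w := D / a D j * V j w.
have mS D j : measurable_fun setT (S D j) by exact: measurable_funM.
have expS D j : 0 < D -> (\int[Pr]_w (expR (S D j w))%:E <= (expR (n%:R * D / 2))%:E)%E.
  move=> D0.
  have -> : S D j = fun w => D / (C * (x j + y) * Num.sqrt D + 2 * K * D) *
      centered_gap Z (gamma (fs j)) (gamma (fs jstar)) w.
    by apply/funext => w; rewrite /S /a; congr (_ / _ * _); ring.
  apply: (@integral_expR_centered_gap_le _ _ _ _ _ _ _ Z _ _ K D
    (C * (x j + y)) (mdist (fs j) (fs jstar))) => //.
  - exact: gamma_meas.
  - exact: gamma_meas.
  - exact: il.
  - exact: il.
  - exact: mdist_ge0.
  - by move=> m m2; exact: exp_moment.
have a0 D j : 0 < D -> 0 < a D j.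
  move=> D0; rewrite /a ltr_wpDl//; last by rewrite !mulr_gt0.
  by rewrite !mulr_ge0 ?sqrtr_ge0 ?addr_ge0// ltW.
have p0 : (0 < p)%N by exact: leq_ltn_trans (leq0n _) (ltn_ord jstar).
have p1R : 1 <= p%:R :> R by rewrite ler1n.
have L0 : 0 < ln (2 * p%:R : R) by apply: ln_gt0; lra.
have Delta0 : 0 < Delta by rewrite /Delta divr_gt0// mulr_gt0.
have nDelta : n%:R * Delta = 2 * ln (2 * p%:R).
  by rewrite /Delta; field; rewrite gt_eqF.
have e2p : expR (ln (2 * p%:R)) = 2 * p%:R :> R by rewrite lnK// posrE; lra.
have mE w0 : measurable [set w | (Ehat w `^ q >= w0)%R].
  exact: (measurable_preimage_ord [set j | x j >= w0]).
have tail t D w0 : D = Delta + 2 * t / n%:R -> 0 < t ->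
    (forall w, w0 <= Ehat w `^ q -> a D (jhat w) <= Ehat w - Estar) ->
    (Pr [set w | (Ehat w `^ q >= w0)%R] <= (expR (- t))%:E)%E.
  move=> DE t0 hw.
  have D0 : 0 < D by rewrite DE addr_gt0// divr_gt0// mulr_gt0.
  apply: (le_trans (@union_chernoff _ _ _ Pr _ (S D) (n%:R * D) (mS D)
    (fun j => expS D j D0) _ (mE w0) _)).
    move=> w /= /hw haw; exists (jhat w).
    have := le_trans haw (erm w).
    rewrite -(ler_pM2l (_ : 0 < n%:R * D / a D (jhat w)))//; last first.
      by rewrite divr_gt0// ?mulr_gt0 ?a0.
    rewrite /S; set aa := a _ _; set v := V _ _.
    have aa0 : 0 < aa by exact: a0.
    have -> : n%:R * D / aa * aa = n%:R * D by field; rewrite gt_eqF.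
    have -> : n%:R * D / aa * (n%:R^-1 * v) = D / aa * v by field; rewrite !gt_eqF.
    by [].
  rewrite lee_fin.
  (* Since [n D / 2 = ln (2 p) + t], the union bound gives [p exp(-t) / (2 p)], half of the
     target. *)
  have -> : - (n%:R * D) / 2 = - ln (2 * p%:R) + - t.
    by rewrite DE mulrDr nDelta; field; rewrite gt_eqF.
  rewrite expRD expRN e2p mulrA ler_piMl ?expR_ge0//.
  rewrite ler_pdivrMr; lra.
(* As [y <= x j], the factor 2 is at most [(x j + y) / y]. This moves the linear term into the
   coefficient of [x j + y] and produces the quotient by the root of [Estar]. *)
have KDy D j : 0 < D -> 0 < y -> 2 * (K * D) <= K * D / y * (x j + y).
  move=> D0 yp; have KD0 : 0 <= K * D / y by rewrite divr_ge0 ?mulr_ge0 ?ltW.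
  apply: (@le_trans _ _ (K * D / y * (2 * y))); last by rewrite ler_wpM2l//; have := yx j; lra.
  by rewrite le_eqVlt; apply/orP; left; apply/eqP; field; rewrite gt_eqF.
(* This rests on [2 ln 2 >= 1], that is [exp(1/2) <= 2], which follows from
   [exp(-1/2) >= 1 - 1/2]. *)
have b1 : 1 + ln p%:R <= n%:R * Delta :> R.
  have ln2 : 1 <= 2 * ln 2 :> R.
    have : expR (2^-1) <= 2 :> R.
      have e0 := expR_gt0 (2^-1 : R); have := expR_ge1Dx (- 2^-1 : R).
      by rewrite expRN -(ler_pM2l e0) mulfV ?gt_eqF//; lra.
    rewrite -ler_ln ?posrE ?expR_gt0// expRK; lra.
  have lp : 0 <= ln p%:R :> R by exact: ln_ge0.
  by rewrite nDelta lnM ?posrE//; lra.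
have bgt0 : 0 < n%:R * Delta by exact: mulr_gt0.
(* Both moment bounds reduce to a deterministic implication, required for every [u >= 0] and used at
   the positive part of the normalised deviation. *)
have moment m y' h : 1 <= m -> m <= (1 + ln p%:R) * (2 * kappa - 1) ->
    0 <= y' -> 0 < h ->
    (forall w u, 0 <= u -> Ehat w - Estar <= u * a Delta (jhat w) ->
       Ehat w `^ q <= y' + h * u `^ r) ->
    ('N[Pr]_(m%:E)[(fun w => (Ehat w `^ q)%:E)] <= (y' + h)%:E)%E.
  move=> m1 mp y'0 h0 hx.
  have mr : m * r <= n%:R * Delta.
    apply: le_trans b1; rewrite /r ler_pdivrMr//; lra.
  have mr0 : 0 <= m * r by rewrite mulr_ge0//; lra.
  have yh0 : 0 < y' + h by lra.
  pose theta := h / (y' + h) * (m * r / (n%:R * Delta)).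
  have t01 : 0 <= theta <= 1.
    apply/andP; split.
      by rewrite mulr_ge0// divr_ge0// ltW.
    apply: mulr_ile1; [exact: divr_ge0 (ltW h0) (ltW yh0)|
      exact: divr_ge0 mr0 (ltW bgt0)| |].
      by rewrite ler_pdivrMr//; lra.
    by rewrite ler_pdivrMr// mul1r.
  apply: (@Lnorm_le_expR _ _ _ Pr _ (S Delta) (n%:R * Delta) (mS Delta)
    (fun j => expS Delta j Delta0) _ _ theta) => //.
  - exact: (measurable_fun_comp_ord x).
  - by move=> w; exact: powR_ge0.
  - exact: ltW.
  - have -> : n%:R * Delta / 2 = ln (2 * p%:R) by rewrite nDelta; field.
    have -> : n%:R * Delta = ln (2 * p%:R) + ln (2 * p%:R) by rewrite nDelta; ring.
    (* The condition reads [1 + 2 p^2 <= 4 p^2]. *)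
    rewrite expRD e2p; have := mulr_ege1 p1R p1R; lra.
  - move=> w; pose u := Num.max 0 (n%:R^-1 * V (jhat w) w / a Delta (jhat w)).
    have u0 : 0 <= u by rewrite le_max lexx.
    have aj0 : 0 < a Delta (jhat w) by exact: a0.
    have hu : Ehat w - Estar <= u * a Delta (jhat w).
      apply: (le_trans (erm w)); rewrite -ler_pdivrMr//.
      by rewrite le_max lexx orbT.
    apply: (le_trans (powR_moment_le m1 r0 y'0 (ltW h0) yh0 (powR_ge0 _ _) u0 bgt0 mr
      (hx w u u0 hu))).
    rewrite ler_wpM2l ?powR_ge0// lerD2l -/theta.
    rewrite ler_wpM2l ?(proj1 (andP t01))// lerD2r.
    have -> : n%:R * Delta * (u - 1) = - (n%:R * Delta) + n%:R * Delta * u by ring.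
    rewrite expRD ler_wpM2l ?expR_ge0//.
    have Se0 j : 0 <= expR (S Delta j w) by exact: expR_ge0.
    (* Either [u] is the deviation itself and its exponential is one of the summands, or [u = 0] and
       the exponential is the leading 1. *)
    rewrite /u maxEle; case: ifP => _.
      rewrite (bigD1 (jhat w))//=.
      have -> : n%:R * Delta * (n%:R^-1 * V (jhat w) w / a Delta (jhat w)) =
          S Delta (jhat w) w by rewrite /S; field; rewrite !gt_eqF.
      by rewrite addrCA lerDl addr_ge0// sumr_ge0.
    by rewrite mulr0 expR0 lerDl sumr_ge0.
split.
- exact: A_const_lt2.
- move=> Es0 t t0; set D := Delta + _.
  have D0 : 0 < D by rewrite addr_gt0// divr_gt0// mulr_gt0.
  have yp : 0 < y by exact: powR_gt0.
  apply: (tail t D) => // w; rewrite EhatE => hx.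
  set b := C * _ + _ in hx.
  have b0 : 0 <= b.
    by rewrite addr_ge0 ?divr_ge0 ?mulr_ge0 ?sqrtr_ge0// ltW.
  have := @excess_ge R kappa kappa_ge1 A b 1 Estar (E (jhat w)) A1 b0 ler01 (E0 jstar) (E0 _).
  rewrite powR1 mulr1 mul1r => /(_ hx); apply: le_trans.
  change (a D (jhat w) <= (C * Num.sqrt D + K * D / y) * (x (jhat w) + y)).
  by rewrite /a [leRHS]mulrDl lerD2l KDy.
- move=> t t0; set D := Delta + _ => Es.
  have D0 : 0 < D by rewrite addr_gt0// divr_gt0// mulr_gt0.
  apply: (tail t D) => // w; rewrite EhatE => hx.
  have b0 : 0 <= C * Num.sqrt D by rewrite mulr_ge0 ?sqrtr_ge0// ltW.
  (* At [u = 1] the factor [1 + u^r] is the 2 in front of the root of [K D]. *)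
  have := @excess_ge_small R kappa kappa_ge1 A _ 1 Estar (E (jhat w)) A1 b0 ler01
    (E0 jstar) (E0 _) _ Es.
  rewrite powR1 !mulr1 mul1r; apply.
  by rewrite [_ * (1 + 1)]mulrC.
- move=> m m1 mp; split=> [Es0|Es].
    have yp : 0 < y by exact: powR_gt0.
    set b := C * _ + _; have b0 : 0 < b.
      apply: addr_gt0 (divr_gt0 (mulr_gt0 K_gt0 Delta0) yp).
      by rewrite mulr_gt0 ?sqrtr_gt0.
    apply: moment => //.
      exact: mulr_gt0 A0 (powR_gt0 _ b0).
    move=> w u u0 hu.
    apply: (root_excess_le kappa_ge1 A1 (ltW b0) u0 (E0 jstar) (E0 (jhat w))).
    apply: (le_trans hu); rewrite -mulrA ler_wpM2l//.
    change (a Delta (jhat w) <= (C * Num.sqrt Delta + K * Delta / y) * (x (jhat w) + y)).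
    by rewrite /a [leRHS]mulrDl lerD2l KDy.
  have b0 : 0 < C * Num.sqrt Delta by rewrite mulr_gt0 ?sqrtr_gt0.
  (* One copy of the root of [K Delta] serves as [y']; the other joins [h], since
     [root_excess_le_small] multiplies it by [u^r]. *)
  have -> : A * (C * Num.sqrt Delta) `^ r + 2 * (K * Delta) `^ q =
    (K * Delta) `^ q + (A * (C * Num.sqrt Delta) `^ r + (K * Delta) `^ q) by ring.
  apply: moment; rewrite ?powR_ge0//.
    apply: addr_gt0 (mulr_gt0 A0 (powR_gt0 _ b0)) (powR_gt0 _ _).
    exact: mulr_gt0.
  move=> w u u0 hu.
  have := root_excess_le_small kappa_ge1 A1 (ltW b0) u0 (E0 jstar) (E0 (jhat w)) Es hu.
  by move=> /le_trans; apply; rewrite le_eqVlt; apply/orP; left; apply/eqP; ring.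
Qed.
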